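(* Let $p$ be an odd prime. For $0<k<p$ let $g_k(\alpha)\in\mathbb F_p(\alpha)$ be as defined in the context, and for an integer $d$ and a parameter $\gamma$ put $\pounds_d^{(\gamma)}(X)=\sum_{k=1}^{p-1}g_k(\gamma)X^k/k^d$; also let $\pounds_d(X)=\sum_{k=1}^{p-1}X^k/k^d$. Let $T(X)=\prod_{i=1}^{p-1}(1+X/i)^i$. Then for any integer $d$, \[ \sum_{r=1}^{p-1}\pounds_d^{(r\alpha^p)}\bigl(T(r\alpha)\,X\bigr)=(\alpha^{p-1}-1)\,\pounds_d(X) \] in $\mathbb F_p(\alpha)[X]$.
   Context: For integers $0<k<p$ and $0<a<p$, $e(k,a)$ is the exponent of the highest power of $p$ dividing $\prod_{s=1}^{k}\binom{sa}{a}$, and $g_k(\alpha)=\prod_{0<a<p}(1+\alpha/a)^{-e(k,a)}$ viewed in $\mathbb F_p(\alpha)$. In $\pounds_d^{(r\alpha^p)}$ the parameter $\gamma$ is replaced by $r\alpha^p$ (with $r$ viewed in $\mathbb F_p$); $1/k^d$ is the inverse of $k^d$ in $\mathbb F_p$. *)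

(* Defs.v *)
From HB Require Import structures.
From mathcomp Require Import all_boot all_order all_algebra.
From mathcomp Require Import fraction.

Set Implicit Arguments.
Unset Strict Implicit.
Unset Printing Implicit Defensive.

Import GRing.Theory.
Local Open Scope ring_scope.

(* The field F_p(alpha) of rational functions; elements of F_p occur in it as
   numerals n%:R, which vanish exactly when p divides n (p prime). *)
Notation ratFp p := {fraction {poly 'F_p}}.

Definition alpha (p : nat) : ratFp p := tofrac 'X.

Definition e (p k a : nat) : nat :=
  logn p (\prod_(1 <= s < k.+1) 'C(s * a, a))%N.

(* The value g_k(gamma) of the rational function g_k at a parameter gamma;
   g_k itself is [g k (alpha p)]. *)
Definition g (p k : nat) (gamma : ratFp p) : ratFp p :=
  \prod_(1 <= a < p) (1 + gamma / a%:R) ^- e p k a.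

Definition polylog (p : nat) (d : int) : {poly ratFp p} :=
  \sum_(1 <= k < p) ((k%:R ^ d)^-1 : ratFp p) *: 'X^k.

Definition polylog_param (p : nat) (d : int) (gamma : ratFp p) :
    {poly ratFp p} :=
  \sum_(1 <= k < p) (g k gamma / k%:R ^ d) *: 'X^k.

(* The coefficients of T lie in F_p; it is taken over F_p(alpha) so that it can
   be evaluated there. *)
Definition T (p : nat) : {poly ratFp p} :=
  \prod_(1 <= i < p) (1 + (i%:R^-1 : ratFp p) *: 'X) ^+ i.

(* Main.v *)
Require Import Defs.
From HB Require Import structures.
From mathcomp Require Import all_boot all_order all_algebra.
From mathcomp Require Import fraction ring zify.

Set Implicit Arguments.
Unset Strict Implicit.
Unset Printing Implicit Defensive.

Import GRing.Theory.
Local Open Scope ring_scope.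

(** Since (k a)! = a!^k prod_s C(s a, a), one has e(k, a) = floor(k a / p); with
    r alpha^p = (r alpha)^p this turns g_k(r alpha^p) T(r alpha)^k into
    prod_a (1 + r alpha / a)^(k a mod p) = T(k r alpha).  After permuting the
    residues r, every coefficient of the theorem reduces to one identity for
    U(X) = sum_(r in F_p) T(r X), namely U = X^(p-1).

    From (X^p - X) T' = X T, the polynomial T is exp(-X) modulo X^p; from
    T(X) X^p = T(X + 1) (X^p - X), T(X - r) is X^r / r! exp(-X) modulo X^p.
    Hence the coefficient of t^n in U(t - 1), n < p, is
    (1/n!) sum_r (-1)^(n-r) C(n, r) r^n = 1, as in (t - 1)^(p-1).  So
    U - X^(p-1) vanishes to order p at -1, hence at all of F_p^* because it is
    invariant under X -> s X, and its degree is too small for that. *)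

Lemma finite_difference_expr (R : comNzRingType) (m n : nat) (y : R) :
  (m <= n)%N ->
  \sum_(r < n.+1) (-1) ^+ (n - r) * 'C(n, r)%:R * (y + r%:R) ^+ m
    = n`!%:R *+ (m == n).
Proof.
elim: m n y => [|m IHm] n y le_mn.
  transitivity ((-1 + 1) ^+ n : R); last first.
    by rewrite addNr expr0n eq_sym; case: n le_mn.
  rewrite exprDn; apply: eq_bigr => r _.
  by rewrite expr1n expr0 !mulr1 mulr_natr.
case: n le_mn => // n le_mn.
transitivity (y * (\sum_(r < n.+2) (-1) ^+ (n.+1 - r)
      * 'C(n.+1, r)%:R * (y + r%:R) ^+ m)
    + n.+1%:R * (\sum_(r < n.+1) (-1) ^+ (n - r) * 'C(n, r)%:R
      * (y + 1 + r%:R) ^+ m)).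
  have absorb (r : nat) : (-1) ^+ (n.+1 - r) * 'C(n.+1, r)%:R
        * (y + r%:R) ^+ m.+1
      = y * ((-1) ^+ (n.+1 - r) * 'C(n.+1, r)%:R * (y + r%:R) ^+ m)
        + (-1) ^+ (n.+1 - r) * (r * 'C(n.+1, r))%:R * (y + r%:R) ^+ m.
    by rewrite exprS natrM; ring.
  under eq_bigr do rewrite absorb.
  rewrite big_split -big_distrr /=; congr (_ + _).
  rewrite big_ord_recl mul0n mulr0 mul0r add0r big_distrr /=.
  apply: eq_bigr => r _; rewrite /bump add1n -mul_bin_diag natrM subSS.
  by rewrite -[y + 1 + _]addrA nat1r; ring.
rewrite !IHm ?(ltnW le_mn) // (ltn_eqF le_mn) mulr0n mulr0 add0r.
by rewrite mulrnAr -natrM -factS eqSS.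
Qed.

Lemma coef_comp_scaleX (R : comNzRingType) (c : R) (P : {poly R}) (n : nat) :
  (P \Po (c *: 'X))`_n = c ^+ n * P`_n.
Proof.
elim/poly_ind: P n => [|P a IHP] n; first by rewrite comp_poly0 !coef0 mulr0.
rewrite comp_poly_MXaddC -scalerAr !(coefD, coefZ, coefMX, coefC).
by case: n => [|n] /=; rewrite ?IHP ?mulr0 ?mul1r // !addr0 exprS mulrA.
Qed.

Lemma size_prod_expn_leq (R : comNzRingType) (I : Type) (s : seq I)
    (P : I -> {poly R}) (n : I -> nat) (d : nat) :
  (forall i, size (P i) <= d.+1)%N ->
  (size (\prod_(i <- s) P i ^+ n i)%R <= (d * \sum_(i <- s) n i).+1)%N.
Proof.
move=> sizeP; elim: s => [|i s IHs]; first by rewrite !big_nil size_poly1.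
rewrite !big_cons mulnDr; apply: leq_trans (size_polyMleq _ _) _.
have : (size (P i ^+ n i)%R <= (d * n i).+1)%N.
  apply: leq_trans (size_poly_exp_leq _ _) _.
  by rewrite ltnS leq_mul2r -subn1 leq_subLR add1n sizeP orbT.
by move: IHs; lia.
Qed.

Lemma dvdXnP (F : fieldType) (n : nat) (P : {poly F}) :
  reflect (forall i, (i < n)%N -> P`_i = 0) ('X^n %| P).
Proof.
apply: (iffP idP) => [/dvdpP[Q ->] i lt_in | P0].
  by rewrite coefMXn lt_in.
rewrite -[P](poly_take_drop n) dvdp_addl ?dvdp_mulIr //.
suff -> : take_poly n P = 0 by rewrite dvdp0.
by apply/polyP => i; rewrite coef_take_poly coef0; case: ifP => // /P0.
Qed.

Lemma XsubC_expn_dvdp_comp (F : fieldType) (n : nat) (a : F) (P : {poly F}) :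
  ('X^n %| P \Po ('X + a%:P)) = (('X - a%:P) ^+ n %| P).
Proof.
apply/idP/idP => [/(dvdp_comp_poly ('X - a%:P))|/(dvdp_comp_poly ('X + a%:P))].
  by rewrite comp_polyXaddC_K comp_Xn_poly.
by rewrite rmorphXn /= comp_polyB comp_polyX comp_polyC addrK.
Qed.

Lemma XsubC_expn_dvdp_comp_scaleX (F : fieldType) (n : nat) (a c : F)
    (P : {poly F}) :
  c != 0 -> ('X - a%:P) ^+ n %| P ->
  ('X - (a / c)%:P) ^+ n %| P \Po (c *: 'X).
Proof.
move=> nz_c /(dvdp_comp_poly (c *: 'X)).
rewrite rmorphXn /= comp_polyB comp_polyX comp_polyC.
have -> : c *: 'X - a%:P = c *: ('X - (a / c)%:P).
  by rewrite scalerBr -[_ *: _%:P]mul_polyC -polyCM mulrC divfK.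
by rewrite exprZn dvdpZl ?expf_neq0.
Qed.

Lemma prod_XsubC_expn_dvdp (F : fieldType) (n : nat) (P : {poly F})
    (s : seq F) :
  uniq s -> {in s, forall z, ('X - z%:P) ^+ n %| P} ->
  (\prod_(z <- s) ('X - z%:P)) ^+ n %| P.
Proof.
elim: s => [|z s IHs]; first by rewrite big_nil expr1n dvd1p.
rewrite cons_uniq => /andP[z_s uniq_s] dvdP.
rewrite big_cons exprMn Gauss_dvdp; last first.
  apply/coprimep_expl/coprimep_expr; rewrite coprimep_sym coprimep_XsubC.
  by rewrite root_prod_XsubC.
rewrite dvdP ?mem_head //= IHs // => y ys.
by apply: dvdP; rewrite inE ys orbT.
Qed.

Lemma roots_expn_geq_poly_eq0 (F : fieldType) (n : nat) (P : {poly F})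
    (s : seq F) :
  uniq s -> {in s, forall z, ('X - z%:P) ^+ n %| P} ->
  (size P <= size s * n)%N -> P = 0.
Proof.
move=> uniq_s dvdP; apply: contraTeq => nzP; rewrite -ltnNge.
apply: leq_trans (dvdp_leq nzP (prod_XsubC_expn_dvdp uniq_s dvdP)).
have := size_exp (\prod_(z <- s) ('X - z%:P)) n.
rewrite size_prod_XsubC /= => <-; rewrite prednK // size_poly_gt0 expf_neq0 //.
by rewrite -size_poly_gt0 size_prod_XsubC.
Qed.

(* Logarithmic derivative, cleared of denominators, with [i = ('X + i) - 'X]. *)
Lemma deriv_prod_XaddC_expn (R : comNzRingType) (m : nat) :
  let A := \prod_(0 <= i < m) ('X + i%:R%:P : {poly R}) in
  let B := \prod_(0 <= i < m) ('X + i%:R%:P : {poly R}) ^+ i in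
  A * B^`() = B * (m%:R * A - 'X * A^`()).
Proof.
elim: m => [|m /= IHm] /=; first by rewrite !big_geq // -polyC1 !derivC; ring.
rewrite !(big_nat_recr m) //=; move: IHm.
set A := \prod_(_ <= _ < _) _; set B := \prod_(_ <= _ < _) _; set Y := 'X + _.
move=> IHm; have derivY : Y^`() = 1 by rewrite derivD derivX derivC addr0.
have derivYX : Y * (Y ^+ m)^`() = m%:R * Y ^+ m.
  rewrite deriv_exp derivY mul1r -mulr_natl mulrCA.
  by case: (m) => [|k]; rewrite ?mul0r // -exprS.
have mE : m%:R = Y - 'X by rewrite /Y polyC_natr addrC addKr.
rewrite !derivM derivY.
transitivity (Y * Y ^+ m * (A * B^`()) + A * B * (Y * (Y ^+ m)^`())).
  by ring.
by rewrite IHm derivYX -natr1 mE; ring.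
Qed.

Lemma eqn_modMl (m k i j : nat) : coprime m k ->
  (k * i == k * j %[mod m])%N = (i == j %[mod m])%N.
Proof.
move=> co_mk; rewrite -!eqz_nat -!modz_nat !eqz_mod_dvd !PoszM -mulrBr.
by rewrite Gauss_dvdzr.
Qed.

Lemma perm_mul_modn_iota (m k : nat) : coprime m k ->
  perm_eq [seq (k * r %% m)%N | r <- index_iota 1 m] (index_iota 1 m).
Proof.
move=> co_mk.
have uniq_mul : uniq [seq (k * r %% m)%N | r <- index_iota 1 m].
  rewrite map_inj_in_uniq ?iota_uniq // => i j.
  rewrite !mem_index_iota => /andP[_ lt_im] /andP[_ lt_jm] /eqP.
  by rewrite eqn_modMl // => /eqP; rewrite !modn_small.
apply: uniq_perm; rewrite ?iota_uniq //.
apply: (uniq_min_size uniq_mul _ _).2; last by rewrite size_map.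
move=> _ /mapP[r + ->]; rewrite !mem_index_iota => /andP[r_gt0 lt_rm].
rewrite ltn_pmod ?(leq_ltn_trans _ lt_rm) // andbT lt0n -/(dvdn m (k * r)).
by rewrite Gauss_dvdr // gtnNdvd.
Qed.

Lemma big_mul_modn (R : Type) (idx : R) (op : Monoid.com_law idx)
    (m k : nat) (G : nat -> R) : coprime m k ->
  \big[op/idx]_(1 <= r < m) G (k * r %% m)%N = \big[op/idx]_(1 <= r < m) G r.
Proof.
by move=> co_mk; rewrite -[RHS](perm_big _ (perm_mul_modn_iota co_mk)) big_map.
Qed.

Lemma coprime_lt_prime (p k : nat) : prime p -> (0 < k < p)%N -> coprime p k.
Proof. by move=> p_pr /andP[k_gt0 lt_kp]; rewrite prime_coprime // gtnNdvd. Qed.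

Lemma logn_fact_lt_sqr (p n : nat) : prime p -> (n < p ^ 2)%N ->
  logn p n`! = (n %/ p)%N.
Proof.
move=> p_pr lt_n; rewrite logn_fact //; case: n lt_n => [|n] lt_n.
  by rewrite big_geq // div0n.
rewrite big_ltn // expn1 big1_seq ?addn0 // => k /=.
rewrite mem_index_iota => /andP[le2k _]; rewrite divn_small //.
by apply: (leq_trans lt_n); rewrite leq_exp2l // prime_gt1.
Qed.

Lemma prod_bin_mul_fact (k a : nat) :
  (\prod_(1 <= s < k.+1) 'C(s * a, a) * a`! ^ k = (k * a)`!)%N.
Proof.
elim: k => [|k IHk]; first by rewrite big_geq.
have := @bin_fact (k.+1 * a) a.
rewrite {1 3}mulSn leq_addr addKn => /(_ isT) <-.
by rewrite big_nat_recr //= expnS -IHk; ring.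
Qed.

Lemma e_divn (p k a : nat) : prime p -> (k < p)%N -> (a < p)%N ->
  e p k a = (k * a %/ p)%N.
Proof.
move=> p_pr lt_kp lt_ap.
have lt_ka : (k * a < p ^ 2)%N by rewrite expnS expn1 ltn_mul.
rewrite -logn_fact_lt_sqr // -prod_bin_mul_fact lognM ?expn_gt0 ?fact_gt0 //.
  rewrite lognX logn_fact_lt_sqr ?divn_small ?muln0 ?addn0 //.
  by rewrite (ltn_trans lt_ap) // -{1}[p]expn1 ltn_exp2l // prime_gt1.
rewrite big_seq_cond; apply: prodn_cond_gt0 => s; rewrite andbT mem_index_iota.
by case/andP=> s_gt0 _; rewrite bin_gt0 leq_pmull.
Qed.

Lemma pnat_pchar (R : nzRingType) (p : nat) :
  p \in [pchar R] -> [pchar R].-nat p.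
Proof.
by move=> pR; rewrite (eq_pnat _ (pcharf_eq pR)) pnat_id ?(pcharf_prime pR).
Qed.

Lemma natrX_pchar (R : nzRingType) (p n : nat) : p \in [pchar R] ->
  n%:R ^+ p = n%:R :> R.
Proof. by move=> pR; apply: pFrobenius_aut_nat pR n. Qed.

Section PrimeCharacteristic.

Variables (F : fieldType) (p : nat).
Hypothesis pF : p \in [pchar F].

Let pPF : p \in [pchar {poly F}] := etrans (pchar_poly F p) pF.
Let p_prime : prime p := pcharf_prime pF.
Let p_gt0 : (0 < p)%N := prime_gt0 p_prime.
Let p_gt1 : (1 < p)%N := prime_gt1 p_prime.

Lemma natf_neq0_lt (i : nat) : (0 < i < p)%N -> i%:R != 0 :> F.
Proof. by case/andP=> i_gt0 lt_ip; rewrite -(dvdn_pcharf pF) gtnNdvd. Qed.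

Lemma eqr_nat_pchar (i j : nat) :
  (i%:R == j%:R :> F) = (i == j %[mod p])%N.
Proof.
rewrite -eqz_nat -!modz_nat eqz_mod_dvd (dvdz_pcharf pF) rmorphB /=.
by rewrite subr_eq0.
Qed.

Lemma natf_inj_lt : {in gtn p &, injective (fun i => i%:R : F)}.
Proof.
move=> i j lt_ip lt_jp /= /eqP; rewrite eqr_nat_pchar => /eqP.
by rewrite !modn_small.
Qed.

Lemma factf_neq0 (n : nat) : (n < p)%N -> n`!%:R != 0 :> F.
Proof.
move=> lt_np; rewrite fact_prod natr_prod prodf_seq_neq0; apply/allP => i.
rewrite mem_index_iota ltnS => /andP[i_gt0 le_in].
by rewrite natf_neq0_lt // i_gt0 (leq_ltn_trans le_in).
Qed.

Lemma expf_pred_nat (i : nat) : (0 < i < p)%N -> i%:R ^+ p.-1 = 1 :> F.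
Proof.
move=> /natf_neq0_lt nz_i; apply: (mulfI nz_i).
by rewrite -exprS prednK // natrX_pchar // mulr1.
Qed.

Lemma expr_XsubC_nat (n : nat) :
  ('X - n%:R%:P) ^+ p = 'X^p - n%:R%:P :> {poly F}.
Proof.
rewrite exprDn_pchar ?exprNn_pchar ?pnat_pchar //.
by rewrite -polyC_exp natrX_pchar.
Qed.

Lemma prod_XaddC_nat :
  \prod_(0 <= i < p) ('X + i%:R%:P) = 'X^p - 'X :> {poly F}.
Proof.
pose s := [seq - i%:R : F | i <- index_iota 0 p].
have ltXp : (size (- 'X : {poly F}) < size ('X^p : {poly F}))%N.
  by rewrite size_polyN size_polyX size_polyXn ltnS.
rewrite (@all_roots_prod_XsubC _ ('X^p - 'X) s).
- rewrite lead_coefDl // lead_coefXn scale1r big_map.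
  by apply: eq_bigr => i _; rewrite polyCN opprK.
- by rewrite size_polyDl // size_polyXn size_map size_iota subn0.
- apply/allP => _ /mapP[i _ ->]; rewrite rootE !hornerE.
  by rewrite exprNn_pchar ?pnat_pchar // natrX_pchar // subrr.
- rewrite uniq_rootsE map_inj_in_uniq ?iota_uniq // => i j.
  by rewrite !mem_index_iota => lt_i lt_j /oppr_inj; apply: natf_inj_lt.
Qed.

Lemma coef_Xsub1_exp_pred (n : nat) : (n < p)%N ->
  (('X - 1) ^+ p.-1 : {poly F})`_n = 1.
Proof.
move=> lt_np; suff -> : ('X - 1) ^+ p.-1 = \poly_(i < p) 1 :> {poly F}.
  by rewrite coef_poly lt_np.
have nz : 'X - 1 != 0 :> {poly F} by rewrite -polyC1 polyXsubC_eq0.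
apply: (mulfI nz); rewrite -exprS prednK // (expr_XsubC_nat 1) polyC1 subrX1.
rewrite poly_def; by congr (_ * _); apply: eq_bigr => i _; rewrite scale1r.
Qed.

Definition polyT : {poly F} :=
  \prod_(1 <= i < p) (1 + (i%:R^-1 : F) *: 'X) ^+ i.

Lemma polyT_horner0 : polyT.[0] = 1.
Proof.
rewrite /polyT horner_prod big1 // => i _.
by rewrite horner_exp !hornerE expr1n.
Qed.

Lemma size_polyT : (size polyT <= 'C(p, 2).+1)%N.
Proof.
rewrite -bin2_sum big_ltn // add0n -[X in X.+1]mul1n.
apply: size_prod_expn_leq => i; apply: leq_trans (size_polyD _ _) _.
rewrite size_poly1 geq_max /=; apply: leq_trans (size_scale_leq _ _) _.
by rewrite size_polyX.
Qed.

Lemma polyT_XaddCE :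
  polyT = (\prod_(1 <= i < p) i%:R ^- i)
            *: \prod_(0 <= i < p) ('X + i%:R%:P) ^+ i.
Proof.
rewrite [X in _ *: X]big_ltn // expr0 mul1r -mul_polyC rmorph_prod.
rewrite -big_split /=.
apply: eq_big_nat => i i_bd; rewrite -exprVn polyC_exp -exprMn; congr (_ ^+ _).
by rewrite mulrDr -polyCM mulVf ?natf_neq0_lt // addrC mul_polyC.
Qed.

Lemma polyT_Xadd1 :
  polyT * 'X^p = (polyT \Po ('X + 1)) * ('X^p - 'X).
Proof.
rewrite polyT_XaddCE comp_polyZ -!scalerAl; congr (_ *: _).
pose G i : {poly F} := ('X + i%:R%:P) ^+ i.
have GS i : G i.+1 = (G i \Po ('X + 1)) * (('X + i%:R%:P) \Po ('X + 1)).
  rewrite -comp_polyM -exprSr rmorphXn /= comp_polyD comp_polyX comp_polyC.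
  by rewrite /G -addrA -polyC1 -polyCD nat1r.
have Gp : G p = 'X^p by rewrite /G pcharf0 // polyC0 addr0.
transitivity (\prod_(0 <= i < p.+1) G i); first by rewrite big_nat_recr //= Gp.
rewrite big_ltn // [G 0%N]expr0 mul1r big_add1 /=.
under eq_bigr do rewrite GS.
rewrite big_split -!rmorph_prod prod_XaddC_nat /=; congr (_ * _).
rewrite comp_polyB comp_Xn_poly comp_polyX exprDn_pchar ?pnat_pchar //.
by rewrite expr1n; ring.
Qed.

Lemma polyT_deriv : ('X^p - 'X) * polyT^`() = 'X * polyT.
Proof.
rewrite polyT_XaddCE derivZ -!scalerAr; congr (_ *: _).
rewrite -prod_XaddC_nat deriv_prod_XaddC_expn prod_XaddC_nat mulrC.
congr (_ * _).
by rewrite derivB derivXn derivX (pcharf0 pPF) (mulrn_pchar pPF); ring.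
Qed.

Lemma coef_polyT (n : nat) : (n < p)%N -> n`!%:R * polyT`_n = (-1) ^+ n.
Proof.
elim: n => [|n IHn] lt_np; first by rewrite -horner_coef0 polyT_horner0 mul1r.
have := congr1 (fun P : {poly F} => P`_n.+1) polyT_deriv.
rewrite /= mulrBl coefB coefXnM lt_np !coefXM /= coef_deriv sub0r => /eqP.
rewrite eqr_oppLR => /eqP derivE.
rewrite factS mulnC natrM -mulrA [n.+1%:R * _]mulr_natl derivE mulrN.
by rewrite IHn ?(ltnW lt_np) // exprS mulN1r.
Qed.

Lemma coef_polyT_XsubS (r n : nat) : (n < p)%N ->
  r.+1%:R * (polyT \Po ('X - r.+1%:R%:P))`_n
    = ('X * (polyT \Po ('X - r%:R%:P)))`_n.
Proof.
move=> lt_np; set T1 := polyT \Po ('X - r.+1%:R%:P); set T0 := polyT \Po _.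
have T01 : T1 * ('X^p - r.+1%:R%:P) = T0 * ('X^p - 'X).
  have := congr1 (fun P => P \Po ('X - r.+1%:R%:P)) polyT_Xadd1.
  rewrite /= !comp_polyM comp_polyB !comp_Xn_poly comp_polyX -comp_polyA.
  rewrite expr_XsubC_nat.
  have -> : ('X + 1) \Po ('X - r.+1%:R%:P) = 'X - r%:R%:P :> {poly F}.
    rewrite comp_polyD comp_polyX -polyC1 comp_polyC -addrA; congr (_ + _).
    by rewrite -polyCN -polyCD -natr1 opprD subrK -polyCN.
  by rewrite -/T1 -/T0 => ->; congr (_ * _); ring.
have := congr1 (fun P : {poly F} => P`_n) T01.
rewrite /= !mulrBr !coefB !coefMXn lt_np !sub0r => /oppr_inj.
by rewrite coefMC mulrC => ->; rewrite mulrC.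
Qed.

Lemma coef_polyT_XsubC (r n : nat) : (r < p)%N -> (n < p)%N ->
  n`!%:R * (polyT \Po ('X - r%:R%:P))`_n = (-1) ^+ (n - r) * 'C(n, r)%:R.
Proof.
elim: r n => [|r IHr] n lt_rp lt_np.
  by rewrite subr0 comp_polyXr bin0 subn0 mulr1 coef_polyT.
have nz_r : r.+1%:R != 0 :> F by rewrite natf_neq0_lt.
apply: (mulfI nz_r); rewrite mulrCA coef_polyT_XsubS // coefXM.
case: n lt_np => [|n] lt_np /=; first by rewrite bin0n !mulr0.
rewrite subSS factS natrM -mulrA IHr ?(ltnW lt_rp) ?(ltnW lt_np) //.
by rewrite mulrCA -natrM mul_bin_diag natrM mulrCA.
Qed.

Definition dilate_sum : {poly F} :=
  \sum_(0 <= r < p) (polyT \Po (r%:R *: 'X)).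

Lemma size_dilate_sum : (size dilate_sum <= 'C(p, 2).+1)%N.
Proof.
apply: leq_trans (size_sum _ _ _) _; apply/bigmax_leqP_seq => r _ _.
apply/leq_sizeP => n ge_n; rewrite coef_comp_scaleX.
by rewrite (leq_sizeP _ _ size_polyT) ?mulr0.
Qed.

Lemma coef_dilate_sum_Xsub1 (n : nat) : (n < p)%N ->
  (dilate_sum \Po ('X - 1))`_n = 1.
Proof.
move=> lt_np; apply: (mulfI (factf_neq0 lt_np)).
rewrite rmorph_sum coef_sum mulr1 big_distrr /=.
transitivity (\sum_(0 <= r < p) (-1) ^+ (n - r) * 'C(n, r)%:R * r%:R ^+ n : F).
  apply: eq_big_nat => r /andP[_ lt_rp]; rewrite -coef_polyT_XsubC //.
  rewrite -mulrA [_ * r%:R ^+ n]mulrC -coef_comp_scaleX -!comp_polyA.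
  rewrite comp_polyZ comp_polyB !comp_polyX comp_polyC scalerBr.
  by rewrite alg_polyC.
rewrite (@big_cat_nat _ _ _ n.+1) //= [X in _ + X]big1_seq ?addr0 => [|r].
  have := @finite_difference_expr F n n 0 (leqnn n); rewrite eqxx mulr1n => <-.
  by rewrite big_mkord; apply: eq_bigr => r _; rewrite add0r.
rewrite mem_index_iota => /andP[_ /andP[lt_nr _]].
by rewrite bin_small // mulr0 mul0r.
Qed.

Lemma dilate_sum_comp_scaleX (s : nat) : (0 < s < p)%N ->
  dilate_sum \Po (s%:R *: 'X) = dilate_sum.
Proof.
move=> s_bd; rewrite /dilate_sum big_ltn // comp_polyD scale0r !comp_poly0r.
rewrite comp_polyC rmorph_sum; congr (_ + _) => /=.
rewrite -[RHS](big_mul_modn _ _ (coprime_lt_prime p_prime s_bd)).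
apply: eq_bigr => r _.
rewrite -comp_polyA comp_polyZ comp_polyX scalerA GRing.natr_mod_pchar //.
by rewrite natrM mulrC.
Qed.

Lemma dilate_sumE : dilate_sum = 'X^(p.-1).
Proof.
pose W := dilate_sum - 'X^(p.-1); apply/eqP; rewrite -subr_eq0 -/W; apply/eqP.
have XD1_dvdW : ('X - (-1)%:P) ^+ p %| W.
  rewrite -XsubC_expn_dvdp_comp polyCN polyC1; apply/dvdXnP => n lt_np.
  rewrite comp_polyB comp_Xn_poly coefB coef_dilate_sum_Xsub1 //.
  by rewrite coef_Xsub1_exp_pred // subrr.
have W_comp_scaleX s : (0 < s < p)%N -> W \Po (s%:R *: 'X) = W.
  move=> s_bd; rewrite comp_polyB comp_Xn_poly dilate_sum_comp_scaleX // exprZn.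
  by rewrite expf_pred_nat // scale1r.
pose zs : seq F := [seq -1 / s%:R | s <- index_iota 1 p].
apply: (@roots_expn_geq_poly_eq0 _ p _ zs).
- rewrite map_inj_in_uniq ?iota_uniq // => i j; rewrite !mem_index_iota.
  move=> /andP[_ lt_ip] /andP[_ lt_jp]; rewrite !mulN1r => /oppr_inj /invr_inj.
  exact: natf_inj_lt.
- move=> _ /mapP[s + ->]; rewrite mem_index_iota => s_bd.
  rewrite -(W_comp_scaleX s s_bd) XsubC_expn_dvdp_comp_scaleX //.
  exact: natf_neq0_lt.
- apply: leq_trans (size_polyD _ _) _.
  rewrite size_map size_iota size_polyN size_polyXn geq_max.
  have binE : (('C(p, 2)).*2 = p * p.-1)%N
    by rewrite -mul2n -mul_bin_diag bin1.
  apply/andP; split; last by nia.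
  by apply: leq_trans size_dilate_sum _; nia.
Qed.

Lemma sum_polyT_horner (k : nat) (x : F) : (0 < k < p)%N ->
  \sum_(1 <= r < p) polyT.[k%:R * (r%:R * x)] = x ^+ p.-1 - 1.
Proof.
move=> k_bd; transitivity (\sum_(1 <= r < p) polyT.[r%:R * x]).
  rewrite -[RHS](big_mul_modn _ _ (coprime_lt_prime p_prime k_bd)).
  by apply: eq_bigr => r _; rewrite GRing.natr_mod_pchar // natrM mulrA.
have := congr1 (fun P : {poly F} => P.[x]) dilate_sumE.
rewrite /dilate_sum big_ltn // scale0r comp_poly0r -horner_coef0 polyT_horner0.
rewrite !hornerE horner_sum => <-; rewrite addrC addKr.
by apply: eq_bigr => r _; rewrite horner_comp hornerZ hornerX.
Qed.

Lemma polyT_horner_mul (k : nat) (x : F) : (0 < k < p)%N ->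
  polyT.[k%:R * x] = \prod_(1 <= a < p) (1 + x / a%:R) ^+ (k * a %% p).
Proof.
move=> k_bd; rewrite /polyT horner_prod.
rewrite -(big_mul_modn _ _ (coprime_lt_prime p_prime k_bd)).
apply: eq_big_nat => a a_bd; rewrite horner_exp hornerD hornerZ hornerX hornerC.
rewrite GRing.natr_mod_pchar // natrM.
have nz_k := natf_neq0_lt k_bd; have nz_a := natf_neq0_lt a_bd.
by congr ((1 + _) ^+ _); field; apply/andP.
Qed.

Lemma prod_exp_divn_polyT_horner (k : nat) (x : F) : (0 < k < p)%N ->
  (forall a, (0 < a < p)%N -> 1 + x / a%:R != 0) ->
  (\prod_(1 <= a < p) (1 + x ^+ p / a%:R) ^- (k * a %/ p)) * polyT.[x] ^+ k
    = polyT.[k%:R * x].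
Proof.
move=> k_bd nz_x; rewrite polyT_horner_mul // -[x in polyT.[x]]mul1r.
rewrite (@polyT_horner_mul 1) // -prodrXl -big_split.
apply: eq_big_nat => a a_bd /=; have nz := nz_x a a_bd.
have -> : 1 + x ^+ p / a%:R = (1 + x / a%:R) ^+ p.
  by rewrite exprDn_pchar ?pnat_pchar // expr1n expr_div_n natrX_pchar.
rewrite mul1n modn_small ?(andP a_bd).2 // -!exprM [(a * k)%N]mulnC.
rewrite {2}(divn_eq (k * a) p) exprD [(p * _)%N]mulnC mulrA mulVf ?mul1r //.
by rewrite expf_neq0.
Qed.

End PrimeCharacteristic.

Lemma pchar_ratFp (p : nat) : prime p -> p \in [pchar ratFp p].
Proof.
move=> p_pr; apply: (rmorph_pchar (@tofrac {poly 'F_p})).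
by rewrite pchar_poly pchar_Fp.
Qed.

Lemma one_add_alpha_div_neq0 (p r a : nat) : prime p ->
  (0 < r < p)%N -> (0 < a < p)%N -> 1 + r%:R * alpha p / a%:R != 0.
Proof.
move=> p_pr r_bd a_bd; have nz_a := natf_neq0_lt (pchar_ratFp p_pr) a_bd.
have -> : 1 + r%:R * alpha p / a%:R = tofrac (r%:R *: 'X + a%:R%:P) / a%:R.
  rewrite -mul_polyC rmorphD rmorphM !rmorph_nat /= -/(alpha p).
  by rewrite mulrDl mulfV // addrC.
rewrite mulf_neq0 ?invr_eq0 // tofrac_eq0.
apply/eqP => /(congr1 (fun P : {poly 'F_p} => P`_1)) /eqP.
rewrite coefD coefZ coefX coefC coef0 mulr1 addr0; apply/negP.
exact: (natf_neq0_lt (pchar_Fp p_pr) r_bd).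
Qed.

Lemma g_mul_T_horner (p k r : nat) :
  prime p -> (0 < k < p)%N -> (0 < r < p)%N ->
  g k (r%:R * alpha p ^+ p) * (T p).[r%:R * alpha p] ^+ k
    = (T p).[k%:R * (r%:R * alpha p)].
Proof.
move=> p_pr k_bd r_bd; have pF := pchar_ratFp p_pr.
rewrite -[T p]/(polyT _ p) -(prod_exp_divn_polyT_horner pF k_bd); last first.
  by move=> a; apply: one_add_alpha_div_neq0.
congr (_ * _); rewrite /g exprMn natrX_pchar //.
apply: eq_big_nat => a /andP[_ lt_ap].
by rewrite e_divn // (andP k_bd).2.
Qed.

Theorem theorem7 (p : nat) (p_prime : prime p) (p_odd : odd p) (d : int) :
  \sum_(1 <= r < p)
     (polylog_param d (r%:R * alpha p ^+ p) \Po ((T p).[r%:R * alpha p] *: 'X))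
  = (alpha p ^+ (p - 1) - 1) *: polylog p d.
Proof.
rewrite /polylog_param /polylog scaler_sumr.
under eq_bigr do rewrite rmorph_sum.
rewrite exchange_big; apply: eq_big_nat => k k_bd /=.
under eq_bigr do rewrite comp_polyZ comp_Xn_poly exprZn scalerA.
rewrite -scaler_suml scalerA; congr (_ *: _).
rewrite subn1 -(sum_polyT_horner (pchar_ratFp p_prime) (alpha p) k_bd).
rewrite big_distrl; apply: eq_big_nat => r r_bd /=.
by rewrite mulrAC g_mul_T_horner.
Qed.
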